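(* Let $G$ be the graph of the standard tessellation of $\mathbb{R}^n$ and let $\Omega$ be a nonempty finite subset of $\mathbb{Z}^n$. Consider $\tilde\Omega$ as a weighted graph with unit weight, and let $T^{(0)}$ be the Dirichlet-to-Neumann map for functions of $(\tilde\Omega,\delta\Omega)$. Then $$\sum_{i=1}^n\lambda_i(T^{(0)})\leq2^{n-1}\sum_{i=1}^n\frac{1}{|E_i(\tilde\Omega)|}\sum_{k=1}^n\ \sum_{\substack{1\leq i_1<i_2<\cdots<i_k\leq n\\ i\in \{i_1,i_2,\dots,i_k\}}}|E_{i_1i_2\cdots i_k}(\partial\Omega)|,$$ where $E_{i_1i_2\cdots i_k}(\partial\Omega)$ is the set of edges in $\partial\Omega$ that are parallel to $e_{i_1}+e_{i_2}+\cdots+e_{i_k}$ and $E_i(\tilde\Omega)$ is the set of edges of $\tilde\Omega$ that are parallel to $e_i$; here $\{e_1,\dots,e_n\}$ is the standard basis of $\mathbb{R}^n$. As a consequence, $$\sum_{i=1}^n\lambda_i(T^{(0)})\leq \frac{n2^{n-1}|\partial\Omega|}{\min_{1\leq i\leq n}|E_i(\tilde\Omega)|}.$$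
   Context: The graph $G$ of the standard tessellation of $\mathbb{R}^n$ has $V(G)=\mathbb{Z}^n$ and $E(G)=\{\{x,y\}: x\ne y\in\mathbb{Z}^n,\ 0\le\min_{1\le i\le n}(y_i-x_i)\le\max_{1\le i\le n}(y_i-x_i)=1\}$, i.e. $x,y$ are adjacent iff one of $y-x$, $x-y$ is a nonzero vector in $\{0,1\}^n$. For $\Omega\subset V(G)$, $\delta\Omega$ is the set of vertices not in $\Omega$ that are adjacent to some vertex of $\Omega$, $\overline\Omega=\Omega\cup\delta\Omega$, and $\tilde\Omega$ is the subgraph of $G$ with vertex set $\overline\Omega$ and edge set $E(\Omega,\overline\Omega)$, the edges of $G$ with one end in $\Omega$ and the other in $\overline\Omega$ (so there are no edges between vertices of $\delta\Omega$). $\partial\Omega=E(\Omega,\delta\Omega)$ is the set of edges with one end in $\Omega$ and the other in $\delta\Omega$. Unit weight means every vertex and every edge (indeed every clique) has weight $1$. The map $T^{(0)}$ acts on functions $\varphi:\delta\Omega\to\mathbb{R}$: let $\omega:\overline\Omega\to\mathbb{R}$ be a solution of $\sum_{y\sim x}(\omega(x)-\omega(y))=0$ for all $x\in\Omega$ (neighbours in $\tilde\Omega$), $\omega|_{\delta\Omega}=\varphi$; then $T^{(0)}\varphi(v)=\sum_{u\in\Omega,\,u\sim v}(\varphi(v)-\omega(u))$ for $v\in\delta\Omega$ (this is well defined). It is a nonnegative self-adjoint operator on the space of functions on $\delta\Omega$ with inner product $\langle\varphi,\psi\rangle=\sum_{v\in\delta\Omega}\varphi(v)\psi(v)$. For a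 nonnegative self-adjoint operator $T$ on a finite-dimensional inner product space, $\lambda_i(T)$ is its $i$-th positive eigenvalue, in ascending order and counted with multiplicity; the statement is understood to include that $\lambda_1,\dots,\lambda_n$ exist. *)

(* Defs.v *)
From HB Require Import structures.
From mathcomp Require Import all_boot all_order all_algebra.
From mathcomp Require Import finmap.
From mathcomp Require Import boolp classical_sets reals.

Set Implicit Arguments.
Unset Strict Implicit.
Unset Printing Implicit Defensive.

Import Order.TTheory GRing.Theory Num.Theory.

Local Open Scope fset_scope.
Local Open Scope ring_scope.

Section Tessellation.
Variable n : nat.
Notation vertex := 'rV[int]_n.
Implicit Types (x y d : vertex) (Om : {fset vertex}) (e : {fset vertex}).

Definition step d : bool :=
  (d != 0) && [forall i, (d ord0 i == 0) || (d ord0 i == 1)].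

Definition adj x y : bool := step (y - x) || step (x - y).

(* e_{i_1} + ... + e_{i_k} for I = {i_1, ..., i_k} *)
Definition evec (I : {set 'I_n}) : vertex := \sum_(i in I) delta_mx ord0 i.

Definition cube : {fset vertex} := [fset evec I | I : {set 'I_n}].

(* The finite set that exhibits the boundary as an fset; the boundary is
   characterized by in_bdry alone. *)
Definition around Om : {fset vertex} :=
  [fset x + d | x in Om, d in cube] `|`
  [fset x - d | x in Om, d in cube].

Definition bdry Om : {fset vertex} :=
  [fset y in around Om | (y \notin Om) && [exists x : Om, adj (val x) y]].

Definition clos Om : {fset vertex} := Om `|` bdry Om.

Definition tilde_adj Om x y : bool :=
  [&& adj x y, x \in clos Om, y \in clos Om & (x \in Om) || (y \in Om)].

(* Edges are unordered pairs {x, y}. *)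
Definition tilde_edges Om : {fset {fset vertex}} :=
  [fset [fset x; y] | x in Om, y in clos Om & adj x y].

Definition bdry_edges Om : {fset {fset vertex}} :=
  [fset [fset x; y] | x in Om, y in bdry Om & adj x y].

Section Real.
Variable R : realType.

Definition parallel e d : Prop :=
  exists x y, e = [fset x; y] /\
    exists c : R, map_mx (intr : int -> R) (y - x) = c *: map_mx intr d.

Definition edges_parallel (E : {fset {fset vertex}}) d : {fset {fset vertex}} :=
  [fset e in E | `[< parallel e d >]].

Definition dirichlet_solution Om (phi : {ffun bdry Om -> R^o})
    (om : {ffun clos Om -> R^o}) : Prop :=
  (forall x : clos Om, val x \in Om ->
     \sum_(y : clos Om | tilde_adj Om (val x) (val y)) (om x - om y) = 0) /\
  (forall (v : bdry Om) (w : clos Om), val w = val v -> om w = phi v).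

Definition dirichlet_extension Om (phi : {ffun bdry Om -> R^o}) :
    {ffun clos Om -> R^o} :=
  xget 0 [set om | dirichlet_solution phi om]%classic.

Definition DtN_fun Om (phi : {ffun bdry Om -> R^o}) : {ffun bdry Om -> R^o} :=
  [ffun v => \sum_(u : clos Om | (val u \in Om) && adj (val u) (val v))
               (phi v - dirichlet_extension phi u)].

(* DtN_fun is linear (DtN_fun_linear), so that linfun does not alter it (DtNE). *)
Definition DtN Om : 'End({ffun bdry Om -> R^o}) := linfun (@DtN_fun Om).

(* s lists the positive eigenvalues of f in ascending order, each repeated
   according to its multiplicity; such an s is unique (positive_spectrum_uniq). *)
Definition positive_spectrum (V : vectType R) (f : 'End(V)) (s : seq R) : Prop :=
  sorted <=%R s /\
  forall a : R, count_mem a s = (if 0 < a then \dim (passmx.leigenspace f a) else 0%N).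

End Real.
End Tessellation.

Arguments edges_parallel {n} R E d.
Arguments DtN {n} R Om.

Section Facts.
Variable n : nat.
Notation vertex := 'rV[int]_n.
Implicit Types (x y d : vertex) (Om : {fset vertex}).

Lemma adjC x y : adj x y = adj y x.
Proof. by rewrite /adj orbC. Qed.

Lemma evecE (I : {set 'I_n}) i : evec I ord0 i = (i \in I)%:R.
Proof.
rewrite /evec summxE; case: (boolP (i \in I)) => iI.
  rewrite (bigD1 i) //= mxE !eqxx big1 ?addr0 // => j /andP[_ ji].
  by rewrite mxE eqxx /= eq_sym (negbTE ji).
by rewrite big1 // => j jI; rewrite mxE eqxx /=; case: eqP => // ij;
  rewrite ij jI in iI.
Qed.

Lemma step_evec d : step d -> d = evec [set i | d ord0 i == 1].
Proof.
case/andP=> _ /forallP h; apply/rowP => i.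
by rewrite evecE inE; case/orP: (h i) => /eqP ->.
Qed.

Lemma in_bdry Om y :
  (y \in bdry Om) = (y \notin Om) && [exists x : Om, adj (val x) y].
Proof.
rewrite !inE /= andb_idl // => /andP[_ /existsP[x /orP[] /step_evec h]].
  apply/orP; left; apply/imfset2P; exists (val x); first exact: valP.
  exists (y - val x); last by rewrite addrC subrK.
  by rewrite h; apply/imfsetP; exists [set i | (y - val x) ord0 i == 1].
apply/orP; right; apply/imfset2P; exists (val x); first exact: valP.
exists (val x - y); last by rewrite opprB addrC subrK.
by rewrite h; apply/imfsetP; exists [set i | (val x - y) ord0 i == 1].
Qed.

Lemma adj_clos Om x y : x \in Om -> adj x y -> y \in clos Om.
Proof.
move=> xO xy; rewrite inE in_bdry; case: (boolP (y \in Om)) => //= _.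
by apply/existsP; exists [` xO].
Qed.

Lemma tilde_adjE Om x y : x \in Om -> tilde_adj Om x y = adj x y.
Proof.
move=> xO; rewrite /tilde_adj xO orTb andbT inE xO /=.
by apply: andb_idr => /(adj_clos xO).
Qed.

Variable R : realType.
Hypothesis n_gt0 : (0 < n)%N.

Lemma dirichlet_max Om (om : {ffun clos Om -> R^o}) :
  dirichlet_solution (0 : {ffun bdry Om -> R^o}) om -> forall x : clos Om, om x <= (0 : R).
Proof.
move=> [harm bd] x0.
pose i0 := Ordinal n_gt0.
have [m _ mP] := @arg_maxP _ R (clos Om) x0 xpredT om isT.
have [p pm pP] := @arg_maxP _ int (clos Om) m (fun y : clos Om => om y == om m)
  (fun y : clos Om => (val y : vertex) ord0 i0) (eqxx _).
apply: (le_trans (mP x0 isT)); rewrite -(eqP pm).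
have := valP p; rewrite inE; case/orP => [pO|pB]; last first.
  by rewrite (bd [` pB] p erefl) ffunE.
pose q := val p + delta_mx ord0 i0 : vertex.
have pq : adj (val p) q.
  rewrite /adj /q addrAC subrr add0r; apply/orP; left; apply/andP; split.
    by apply/eqP => /rowP /(_ i0) /eqP; rewrite !mxE !eqxx.
  by apply/forallP => i; rewrite mxE eqxx /=; case: (i == i0).
have qC := adj_clos pO pq.
have /psumr_eq0P := harm p pO.
have ge0 (y : clos Om) : tilde_adj Om (val p) (val y) -> 0 <= om p - om y.
  by move=> _; rewrite subr_ge0 (eqP pm); exact: mP.
move=> /(_ ge0) /(_ [` qC]); rewrite tilde_adjE // => /(_ pq) /eqP.
rewrite subr_eq0 (eqP pm) eq_sym => /pP /=.
by rewrite /q !mxE !eqxx /= gerDl ler10.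
Qed.

Lemma dirichlet_solution_uniq Om (phi : {ffun bdry Om -> R^o}) om1 om2 :
  dirichlet_solution phi om1 -> dirichlet_solution phi om2 -> om1 = om2.
Proof.
have le om om' : dirichlet_solution phi om -> dirichlet_solution phi om' ->
    forall x : clos Om, (om x : R) <= om' x.
  move=> [h1 b1] [h2 b2] x.
  suff /dirichlet_max/(_ x) : dirichlet_solution 0 (om - om').
    by rewrite !ffunE subr_le0.
  split=> [z zO|v w vw]; last by rewrite !ffunE (b1 v) // (b2 v) // subrr.
  rewrite (eq_bigr (fun y : clos Om => (om z - om y) - (om' z - om' y))).
    by rewrite sumrB h1 // h2 // subrr.
  by move=> y _; rewrite !ffunE /= !opprD !opprK addrACA.
by move=> s1 s2; apply/ffunP => x; apply/le_anti; rewrite !le.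
Qed.

Lemma dirichlet_solution_linear Om a (phi psi : {ffun bdry Om -> R^o}) om1 om2 :
  dirichlet_solution phi om1 -> dirichlet_solution psi om2 ->
  dirichlet_solution (a *: phi + psi) (a *: om1 + om2).
Proof.
move=> [h1 b1] [h2 b2]; split=> [x xO|v w vw].
  rewrite (eq_bigr (fun y : clos Om => a * (om1 x - om1 y) + (om2 x - om2 y))).
    by rewrite big_split /= -mulr_sumr h1 // h2 // mulr0 addr0.
  by move=> y _; rewrite !ffunE /= opprD addrACA mulrBr.
by rewrite !ffunE (b1 v) // (b2 v).
Qed.

Lemma dirichlet_solution_exists Om (phi : {ffun bdry Om -> R^o}) :
  exists om, dirichlet_solution phi om.
Proof.
pose L (om : {ffun clos Om -> R^o}) : {ffun clos Om -> R^o} :=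
  [ffun x : clos Om => if val x \in Om then
     \sum_(y : clos Om | tilde_adj Om (val x) (val y)) (om x - om y)
   else om x].
have Llin : linear L.
  move=> a u v; apply/ffunP => x; rewrite !ffunE; case: ifP => // _.
  rewrite /GRing.scale /= mulr_sumr -big_split /=; apply: eq_bigr => y _.
  by rewrite !ffunE /GRing.scale /= opprD addrACA mulrBr.
pose HL := GRing.isLinear.Build R _ _ _ L Llin.
pose L' : {linear {ffun clos Om -> R^o} -> {ffun clos Om -> R^o}} :=
  HB.pack L HL.
have ker0 : lker (linfun L') == 0%VS.
  apply/lker0P => u v; rewrite !lfunE /= => e.
  apply/eqP; rewrite -subr_eq0; apply/eqP.
  have Le : L (u - v) = 0 by rewrite -[L]/(L' : _ -> _) linearB /= e subrr.
  apply: (@dirichlet_solution_uniq _ 0); split.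
  - by move=> x xO; have /ffunP/(_ x) := Le; rewrite !ffunE xO => Lx;
      rewrite -[RHS]Lx; apply: eq_bigr => y _; rewrite !ffunE.
  - move=> b w bw; have /ffunP/(_ w) := Le; rewrite !ffunE.
    by have := valP b; rewrite -bw in_bdry => /andP[/negbTE -> _].
  - by move=> x xO; rewrite big1 // => y _; rewrite !ffunE subrr.
  - by move=> b w bw; rewrite !ffunE.
pose g : {ffun clos Om -> R^o} :=
  [ffun x : clos Om => if insub (val x) is Some v then phi v else 0 : R^o].
exists ((linfun L')^-1%VF g).
have Lg : L ((linfun L')^-1%VF g) = g.
  by rewrite -[L _](lfunE L') -[RHS](lker0_lfunVK ker0).
have gE (x : clos Om) : val x \in Om -> g x = 0.
  move=> xO; rewrite ffunE insubN //.
  by rewrite in_bdry xO.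
split=> [x xO|v w vw]; first by have /ffunP/(_ x) := Lg;
  rewrite ffunE xO => ->; exact: gE.
have wO : (val w \in Om) = false.
  by have := valP v; rewrite -vw in_bdry => /andP[/negbTE].
have /ffunP/(_ w) := Lg; rewrite ffunE wO => ->.
by rewrite ffunE vw valK.
Qed.

Lemma dirichlet_extensionP Om (phi : {ffun bdry Om -> R^o}) :
  dirichlet_solution phi (dirichlet_extension phi).
Proof. exact: (xgetPex 0 (dirichlet_solution_exists phi)). Qed.

Lemma DtN_fun_linear Om : linear (@DtN_fun n R Om).
Proof.
move=> a u v; apply/ffunP => x; rewrite !ffunE.
rewrite /GRing.scale /= mulr_sumr -big_split /=; apply: eq_bigr => y _.
have -> : dirichlet_extension (a *: u + v) =
    a *: dirichlet_extension u + dirichlet_extension v.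
  apply: (dirichlet_solution_uniq (dirichlet_extensionP _)).
  exact: dirichlet_solution_linear (dirichlet_extensionP _)
    (dirichlet_extensionP _).
by rewrite !ffunE /GRing.scale /= opprD addrACA mulrBr.
Qed.

Lemma DtNE Om (phi : {ffun bdry Om -> R^o}) om (v : bdry Om) :
  dirichlet_solution phi om ->
  DtN R Om phi v =
    \sum_(u : clos Om | (val u \in Om) && adj (val u) (val v)) (phi v - om u).
Proof.
move=> om_sol.
pose HL := GRing.isLinear.Build R _ _ _ (@DtN_fun n R Om) (DtN_fun_linear (Om:=Om)).
pose L : {linear {ffun bdry Om -> R^o} -> {ffun bdry Om -> R^o}} :=
  HB.pack (@DtN_fun n R Om) HL.
rewrite -[DtN R Om]/(linfun L) lfunE /= ffunE.
by rewrite (dirichlet_solution_uniq om_sol (dirichlet_extensionP phi)).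
Qed.

End Facts.

Lemma positive_spectrum_uniq (R : realType) (V : vectType R) (f : 'End(V))
    (s t : seq R) :
  positive_spectrum f s -> positive_spectrum f t -> s = t.
Proof.
move=> [ss sc] [ts tc]; apply: (sorted_eq le_trans le_anti ss ts).
by apply/allP => a _; rewrite /= sc tc.
Qed.

(* Main.v *)
Require Import Defs.
From mathcomp Require Import all_boot all_order all_algebra.
From mathcomp Require Import complex ring lra.
From mathcomp Require Import finmap.
From mathcomp Require Import boolp classical_sets reals.
Import Order.TTheory GRing.Theory Num.Theory.
Local Open Scope fset_scope.
Local Open Scope ring_scope.

Set Implicit Arguments.
Unset Strict Implicit.
Unset Printing Implicit Defensive.

(* The coordinate functions x_i are harmonic, since the neighbours of a vertex
   come in pairs x + d, x - d.  Let f_i be the restriction of x_i to the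
   boundary.  By Green's formula <T f_i, f_j> is the Dirichlet pairing of x_i
   and x_j; keeping only the edges parallel to some e_i shows that the matrix
   A = (<T f_i, f_j>) dominates the diagonal matrix D of the |E_i|.  If u_a is
   an orthonormal eigenbasis of T with eigenvalues mu_a, the matrix
   G = (sqrt mu_a <f_i, u_a>) satisfies A = G G^T, and the diagonal entries w_a
   of the projection G^T A^-1 G lie in [0, 1] and have sum n, so the n smallest
   positive eigenvalues have sum at most
   sum_a mu_a w_a <= sum_i |T f_i|^2 / D_i, because A^-1 <= D^-1.  Finally,
   T f_i (v) is a sum, over the 2^(n-1) directions I containing i, of the
   signed numbers (-1, 0 or 1) of edges from v parallel to e_I, and Cauchy-Schwarz
   gives |T f_i|^2 <= 2^(n-1) sum_(I containing i) |E_I|. *)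

(** * The spectral theorem for real symmetric matrices *)

Lemma mulmx_tr_sum (R : pzRingType) n (v w : 'rV[R]_n) :
  (v *m w^T) 0 0 = \sum_i v 0 i * w 0 i.
Proof. by rewrite mxE; apply: eq_bigr => i _; rewrite mxE. Qed.

Lemma mulmx_tr_ge0 (R : realDomainType) n (v : 'rV[R]_n) : 0 <= (v *m v^T) 0 0.
Proof.
by rewrite mulmx_tr_sum; apply: sumr_ge0 => i _; rewrite -expr2 sqr_ge0.
Qed.

Lemma mulmx_tr_eq0 (R : realDomainType) n (v : 'rV[R]_n) :
  ((v *m v^T) 0 0 == 0) = (v == 0).
Proof.
apply/eqP/eqP => [|->]; last by rewrite mul0mx mxE.
rewrite mulmx_tr_sum => /psumr_eq0P h; apply/rowP => i; rewrite mxE.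
by apply/eqP; rewrite -sqrf_eq0 expr2 h // => j _; rewrite -expr2 sqr_ge0.
Qed.

Lemma mulmx_tr_gt0 (R : realDomainType) n (v : 'rV[R]_n) :
  v != 0 -> 0 < (v *m v^T) 0 0.
Proof. by move=> v0; rewrite lt_def mulmx_tr_eq0 v0 mulmx_tr_ge0. Qed.

(* If x + i y is a complex eigenvector for a + i b, then symmetry forces
   b (|x|^2 + |y|^2) = 0, so x and y are real eigenvectors for a. *)
Lemma symmetric_eigenvector (R : rcfType) n (A : 'M[R]_n.+1) : A^T = A ->
  exists a, exists2 v : 'rV[R]_n.+1, v != 0 & v *m A = a *: v.
Proof.
move=> symA; pose C : numClosedFieldType := R[i].
pose A' : 'M[C]_n.+1 := map_mx (real_complex R) A.
have [l /eigenvalueP[v vA v0]] := eigenvalue_closed A' (ltn0Sn n).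
pose x : 'rV[R]_n.+1 := \row_i complex.Re (v 0 i).
pose y : 'rV[R]_n.+1 := \row_i complex.Im (v 0 i).
set a := complex.Re l; set b := complex.Im l.
have ReD (p q : R[i]) : complex.Re (p + q) = complex.Re p + complex.Re q.
  by case: p; case: q.
have ImD (p q : R[i]) : complex.Im (p + q) = complex.Im p + complex.Im q.
  by case: p; case: q.
have ReM (p q : R[i]) : complex.Re (p * q) =
    complex.Re p * complex.Re q - complex.Im p * complex.Im q.
  by case: p; case: q.
have ImM (p q : R[i]) : complex.Im (p * q) =
    complex.Re p * complex.Im q + complex.Im p * complex.Re q.
  by case: p; case: q.
have xA : x *m A = a *: x - b *: y.
  apply/rowP => j; have /rowP/(_ j)/(congr1 (@complex.Re R)) := vA.
  rewrite !mxE (big_morph _ ReD (erefl _)) ReM => <-.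
  by apply: eq_bigr => i _; rewrite !mxE ReM /= mulr0 subr0.
have yA : y *m A = a *: y + b *: x.
  apply/rowP => j; have /rowP/(_ j)/(congr1 (@complex.Im R)) := vA.
  rewrite !mxE (big_morph _ ImD (erefl _)) ImM => <-.
  by apply: eq_bigr => i _; rewrite !mxE ImM /= mulr0 add0r.
have xy0 : (x != 0) || (y != 0).
  rewrite -negb_and; apply: contra v0 => /andP[/eqP/rowP x0 /eqP/rowP y0].
  apply/eqP/rowP => i; move: (x0 i) (y0 i); rewrite !mxE.
  by case: (v 0 i) => p q /= -> ->.
have b0 : b = 0.
  have : (x *m A *m y^T) 0 0 = (x *m (y *m A)^T) 0 0.
    by rewrite trmx_mul symA mulmxA.
  have -> : (y *m A)^T = a *: y^T + b *: x^T by rewrite yA linearD !linearZ.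
  rewrite xA mulmxDr mulmxBl -!scalemxAl -!scalemxAr.
  have mxB (B D : 'M[R]_1) c d : (c *: B - d *: D) 0 0 = c * B 0 0 - d * D 0 0.
    by rewrite !mxE.
  have mxD (B D : 'M[R]_1) c d : (c *: B + d *: D) 0 0 = c * B 0 0 + d * D 0 0.
    by rewrite !mxE.
  rewrite mxB mxD => /addrI/eqP.
  rewrite -subr_eq0 -opprD oppr_eq0 -mulrDr mulf_eq0 => /orP[/eqP //|].
  rewrite paddr_eq0 ?mulmx_tr_ge0 // !mulmx_tr_eq0 => /andP[/eqP y0 /eqP x0].
  by rewrite x0 y0 eqxx in xy0.
exists a; case/orP: xy0 => [x0|y0]; [exists x | exists y] => //.
  by rewrite xA b0 scale0r subr0.
by rewrite yA b0 scale0r addr0.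
Qed.

(* Householder: [1 - (2/|w|^2) w^T w] with [w = v - e_0] reflects e_0 to v. *)
Lemma orthogonal_with_row (R : realFieldType) n (v : 'rV[R]_n.+1) :
  v *m v^T = 1%:M -> exists2 Q : 'M[R]_n.+1, Q *m Q^T = 1%:M & row 0 Q = v.
Proof.
move=> v1; pose e : 'rV[R]_n.+1 := delta_mx 0 0.
have e1 : e *m e^T = 1%:M.
  by apply/matrixP => i j; rewrite trmx_delta mul_delta_mx !ord1 !mxE.
have [<-|ve] := eqVneq e v.
  by exists 1%:M; rewrite ?trmx1 ?mulmx1 // rowE mulmx1.
pose w := v - e; pose s := (w *m w^T) 0 0.
have s0 : s != 0 by rewrite mulmx_tr_eq0 subr_eq0 eq_sym.
have ws : w *m w^T = s%:M by rewrite [LHS]mx11_scalar.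
pose Q : 'M[R]_n.+1 := 1%:M - (2 / s) *: (w^T *m w).
have QT : Q^T = Q.
  by rewrite linearB /= linearZ /= trmx_mul trmxK trmx1.
exists Q.
  have MM : (w^T *m w) *m (w^T *m w) = s *: (w^T *m w).
    by rewrite mulmxA -(mulmxA _ w) ws mul_mx_scalar -scalemxAl.
  rewrite QT mulmxBl mul1mx mulmxBr mulmx1 -scalemxAl -scalemxAr MM !scalerA.
  have -> : 2 / s * (2 / s) * s = 2 / s + 2 / s by field.
  by rewrite scalerDl opprB addrK subrK.
rewrite rowE mulmxBr mulmx1 -/e -scalemxAr mulmxA.
have ev : e *m v^T = v *m e^T.
  apply/matrixP => i j; rewrite !ord1 !mulmx_tr_sum.
  by apply: eq_bigr => k _; rewrite mulrC.
have wT : w^T = v^T - e^T by rewrite linearB.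
(* Since [e] and [v = e + w] are both unit vectors, [|w|^2 = -2 <e, w>]. *)
have ew : e *m w^T = (- s / 2)%:M.
  have : s%:M = - (e *m w^T) - (e *m w^T).
    rewrite -ws {1}/w mulmxBl; congr (_ - _).
    by rewrite wT !mulmxBr v1 e1 ev opprB.
  move=> /matrixP/(_ 0 0) h; apply/matrixP => i j; rewrite !ord1.
  by move: h; rewrite !mxE eqxx !mulr1n => ->; field.
rewrite ew mul_scalar_mx scalerA.
have -> : 2 / s * (- s / 2) = -1 by field.
by rewrite scaleN1r opprK addrC subrK.
Qed.

(** Induction on the size: a unit eigenvector is completed to an orthogonal [Q]. By symmetry
    [Q A Q^T] is block diagonal, and the induction hypothesis diagonalises its lower right block. *)
Lemma symmetric_spectral (R : rcfType) n (A : 'M[R]_n) : A^T = A ->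
  exists P : 'M[R]_n, exists2 d : 'rV[R]_n,
    P *m P^T = 1%:M & P *m A = diag_mx d *m P.
Proof.
elim: n A => [|n IH] A symA.
  by exists 1%:M, 0; apply/matrixP => -[].
have [a [v0 v0_neq0 v0A]] := symmetric_eigenvector symA.
pose s := (v0 *m v0^T) 0 0; have s_gt0 : 0 < s := mulmx_tr_gt0 v0_neq0.
pose v := (Num.sqrt s)^-1 *: v0.
have vv : v *m v^T = 1%:M.
  rewrite /v linearZ /= -scalemxAl -scalemxAr scalerA -invfM -expr2.
  rewrite sqr_sqrtr ?(ltW s_gt0) // [_ *m _]mx11_scalar scale_scalar_mx mulVf //.
  by rewrite gt_eqF.
have vA : v *m A = a *: v by rewrite -scalemxAl v0A scalerA mulrC -scalerA.
have [Q QQ Qv] := orthogonal_with_row vv.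
have QQ' := mulmx1C QQ.
pose B : 'M[R]_(1 + n) := Q *m A *m Q^T.
have symB : B^T = B by rewrite /B !trmx_mul trmxK symA mulmxA.
have rowB j : B 0 j = a * (j == 0)%:R.
  have -> : B 0 j = row 0 B 0 j by rewrite [RHS]mxE.
  by rewrite /B !row_mul Qv vA -scalemxAl -Qv -row_mul QQ !mxE eq_sym.
have [|P [d PP PB]] := IH (drsubmx B); first by rewrite trmx_drsub symB.
pose P' : 'M[R]_(1 + n) := block_mx 1%:M 0 0 P.
have BE : B = block_mx a%:M 0 0 (drsubmx B).
  have ur : ursubmx B = 0.
    apply/matrixP => i j; rewrite [LHS]mxE [LHS]mxE ord1 lshift0 rowB.
    by rewrite mulr0 mxE.
  rewrite -{1}[B]submxK ur -[dlsubmx B]trmxK trmx_dlsub symB ur trmx0.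
  congr block_mx; apply/matrixP => i j; rewrite 2![LHS]mxE !ord1 lshift0 rowB mxE.
  by rewrite !eqxx mulr1 mulr1n.
have PP' : P' *m P'^T = 1%:M.
  rewrite tr_block_mx !trmx0 trmx1 mulmx_block !mulmx0 !mul0mx !addr0 !add0r PP.
  by rewrite mulmx1 -scalar_mx_block.
have PB' : P' *m B = diag_mx (row_mx a%:M d) *m P'.
  rewrite diag_mx_row BE !mulmx_block !mulmx0 !mul0mx !addr0 !add0r PB.
  rewrite mulmx1 mul1mx; congr block_mx.
  by apply/matrixP => i j; rewrite !ord1 !mxE eqxx.
exists (P' *m Q), (row_mx a%:M d).
  by rewrite trmx_mul mulmxA -(mulmxA P') QQ mulmx1.
by rewrite mulmxA -PB' /B -!mulmxA QQ' mulmx1.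
Qed.

(** * The Euclidean space of real functions on a finite set *)

Section FunctionSpace.
Variables (R : realType) (J : finType).
Notation V := {ffun J -> R^o}.
Implicit Types (phi psi : V) (f : 'End(V)).

Definition ffdot phi psi : R := \sum_v phi v * psi v.

Lemma ffdotC phi psi : ffdot phi psi = ffdot psi phi.
Proof. by apply: eq_bigr => v _; rewrite mulrC. Qed.

Lemma ffdotDl phi1 phi2 psi :
  ffdot (phi1 + phi2) psi = ffdot phi1 psi + ffdot phi2 psi.
Proof. by rewrite -big_split; apply: eq_bigr => v _; rewrite ffunE mulrDl. Qed.

Lemma ffdotZl a phi psi : ffdot (a *: phi) psi = a * ffdot phi psi.
Proof. by rewrite mulr_sumr; apply: eq_bigr => v _; rewrite ffunE mulrA. Qed.

Lemma ffdot0l psi : ffdot 0 psi = 0.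
Proof. by rewrite -(scale0r 0) ffdotZl mul0r. Qed.

Lemma ffdot_suml (I : Type) (r : seq I) (P : pred I) (F : I -> V) psi :
  ffdot (\sum_(i <- r | P i) F i) psi = \sum_(i <- r | P i) ffdot (F i) psi.
Proof. exact: (big_morph (ffdot^~ psi) (fun x y => ffdotDl x y psi) (ffdot0l psi)). Qed.

Definition ffdelta (v : J) : V := [ffun w => (v == w)%:R].

Lemma ffdot_delta phi v : ffdot phi (ffdelta v) = phi v.
Proof.
rewrite /ffdot (bigD1 v) //= ffunE eqxx mulr1 big1 ?addr0 // => w wv.
by rewrite ffunE eq_sym (negbTE wv) mulr0.
Qed.

Lemma ffun_delta_sum phi : phi = \sum_v phi v *: ffdelta v.
Proof.
apply/ffunP => w; rewrite sum_ffunE (bigD1 w) //= !ffunE eqxx.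
rewrite [_ *: _]mulr1 big1 ?addr0 // => v vw.
by rewrite !ffunE (negbTE vw) [_ *: _]mulr0.
Qed.

Definition ffdot_selfadjoint f := forall phi psi, ffdot (f phi) psi = ffdot phi (f psi).

Definition ffdot_orthonormal (u : 'I_#|J| -> V) :=
  forall a b, ffdot (u a) (u b) = (a == b)%:R.

(** Diagonalises the matrix of [f] in the basis of the [ffdelta v], with [J] numbered by
    [enum_rank]; the rows of [P] are the eigenfunctions. *)
Lemma ffun_spectral f : ffdot_selfadjoint f ->
  exists (u : 'I_#|J| -> V) (mu : 'I_#|J| -> R),
  [/\ ffdot_orthonormal u, forall a, f (u a) = mu a *: u a
    & forall phi, phi = \sum_a ffdot phi (u a) *: u a].
Proof.
move=> symf.
pose A : 'M[R]_#|J| := \matrix_(a, b) f (ffdelta (enum_val a)) (enum_val b).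
have symA : A^T = A.
  apply/matrixP => a b; rewrite !mxE -[LHS]ffdot_delta symf ffdotC.
  exact: ffdot_delta.
have [P [d PP PA]] := symmetric_spectral symA.
have PP' := mulmx1C PP.
have sumJ (F : J -> R) : \sum_v F v = \sum_(b < #|J|) F (enum_val b).
  rewrite (reindex (@enum_val J predT)) //.
  exact: onW_bij (enum_val_bij J).
exists (fun a => [ffun v => P a (enum_rank v)]), (fun a => d 0 a); split.
- move=> a b; move/matrixP/(_ a b): PP; rewrite !mxE => <-.
  by rewrite /ffdot sumJ; apply: eq_bigr => c _; rewrite !ffunE enum_valK mxE.
- move=> a; apply/ffunP => w.
  set u := [ffun v => P a (enum_rank v)] : V.
  rewrite [u in LHS]ffun_delta_sum linear_sum sum_ffunE sumJ.
  have /matrixP/(_ a (enum_rank w)) := PA; rewrite mul_diag_mx !mxE.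
  have -> : (d 0 a *: u) w = d 0 a * P a (enum_rank w) by rewrite !ffunE.
  move=> <-; apply: eq_bigr => b _.
  by rewrite linearZ !ffunE enum_valK !mxE enum_rankK.
- move=> phi; apply/ffunP => w; rewrite sum_ffunE.
  (* Completeness of the eigenbasis is the orthogonality of the columns, [P^T P = 1]. *)
  transitivity (\sum_b (phi (enum_val b) : R) * (P^T *m P) b (enum_rank w)).
    rewrite PP' (bigD1 (enum_rank w)) //= big1 => [|b bw].
      by rewrite mxE eqxx mulr1 addr0 enum_rankK.
    by rewrite mxE (negbTE bw) mulr0.
  under eq_bigr do rewrite mxE mulr_sumr.
  rewrite exchange_big; apply: eq_bigr => a _; rewrite !ffunE /ffdot sumJ.
  rewrite [RHS]mulr_suml.
  by apply: eq_bigr => b _; rewrite ffunE enum_valK mxE mulrA.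
Qed.

End FunctionSpace.

(** * Sums of the smallest positive eigenvalues *)

(** Taken over indices rather than values, so that multiplicities are kept. *)
Definition positives (R : realType) (I : finType) (mu : I -> R) : seq R :=
  sort <=%R [seq mu a | a <- enum I & 0 < mu a].

Lemma sum_positives (R : realType) (I : finType) (mu : I -> R) (F : R -> R) :
  \sum_(x <- positives mu) F x = \sum_(a | 0 < mu a) F (mu a).
Proof.
by rewrite (perm_big _ (permEl (perm_sort _ _))) big_map big_filter enumT.
Qed.

Lemma size_positives (R : realType) (I : finType) (mu : I -> R) :
  size (positives mu) = #|[pred a | 0 < mu a]|.
Proof. by rewrite size_sort size_map size_filter cardE enumT size_filter. Qed.

(* For [t] the [n]-th smallest positive value, the weighted sum of [mu - t] is
   at least the sum of its negative parts. *)
Lemma sum_smallest_le (R : realType) (I : finType) (mu w : I -> R) (n : nat) :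
    (forall a, 0 <= mu a) -> (forall a, 0 <= w a <= 1) ->
    (forall a, mu a = 0 -> w a = 0) -> \sum_a w a = n%:R ->
  (n <= size (positives mu))%N /\
  \sum_(i < n) (positives mu)`_i <= \sum_a mu a * w a.
Proof.
move=> mu0 w01 w0 wn; set s := positives mu.
have drop0 F : (forall a, mu a = 0 -> F a = 0) ->
    \sum_a F a = \sum_(a | 0 < mu a) F a :> R.
  move=> F0; rewrite (bigID (fun a => 0 < mu a)) /= addrC big1 ?add0r // => a.
  by rewrite lt_def mu0 andbT negbK => /eqP /F0.
(* The weights are at most 1 and vanish where [mu] does, so at least [n] of the [mu a] are
   positive. *)
have ns : (n <= size s)%N.
  rewrite -(ler_nat R) -wn size_positives drop0 // -sum1_card natr_sum.
  by apply: ler_sum => a _; case/andP: (w01 a).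
split=> //; case: n wn ns => [|n] wn ns.
  rewrite big_ord0; apply: sumr_ge0 => a _.
  by rewrite mulr_ge0 //; case/andP: (w01 a).
(* Here [n] is one less than the number of summands, so [t] is the largest value that is summed. *)
pose t := s`_n.
have srt : sorted <=%R s := sort_sorted le_total _.
have le_s i j : (i <= j)%N -> (j < size s)%N -> s`_i <= s`_j.
  move=> ij js; apply: (sorted_leq_nth le_trans le_refl 0 srt) => //.
  by rewrite inE (leq_ltn_trans ij js).
have : \sum_(x <- s) Num.min (x - t) 0 <= \sum_(a | 0 < mu a) (mu a - t) * w a.
  rewrite sum_positives; apply: ler_sum => a _; case/andP: (w01 a) => wa0 wa1.
  have [le0|ge0] := leP (mu a - t) 0.
    by rewrite -[X in X <= _]mulr1; apply: ler_wnM2l.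
  by rewrite mulr_ge0 // ltW.
(* The first [n.+1] minima are [s_i - t] and the later ones are 0; the multiples of [t] cancel
   because the weights sum to [n.+1]. *)
rewrite (big_nth 0) (big_cat_nat _ ns) //= big_mkord.
rewrite (eq_bigr (fun i : 'I_n.+1 => s`_i - t)) => [|i _]; last first.
  by rewrite min_l // subr_le0 le_s // -ltnS.
rewrite [X in _ + X]big_nat_cond [X in _ + X]big1 ?addr0 =>
  [|i /andP[/andP[ni ils] _]]; last first.
  by rewrite min_r // subr_ge0 le_s // ltnW.
rewrite sumrB sumr_const card_ord.
rewrite (eq_bigr (fun a => mu a * w a - t * w a)) => [|a _]; last by rewrite mulrBl.
rewrite sumrB -mulr_sumr -!drop0 => // [|a ->]; last by rewrite mul0r.
by rewrite wn mulr_natr lerD2r.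
Qed.

Section Spectrum.
Variables (R : realType) (J : finType).
Notation V := {ffun J -> R^o}.
Variables (f : 'End(V)) (u : 'I_#|J| -> V) (mu : 'I_#|J| -> R).
Hypotheses (u_on : ffdot_orthonormal u) (fu : forall a, f (u a) = mu a *: u a).
Hypothesis u_full : forall phi, phi = \sum_a ffdot phi (u a) *: u a.

Lemma ffdot_eigen phi a : ffdot (f phi) (u a) = mu a * ffdot phi (u a).
Proof.
rewrite {1}[phi]u_full linear_sum ffdot_suml (bigD1 a) //= big1 => [|b ba].
  by rewrite linearZ /= fu !ffdotZl u_on eqxx mulr1 addr0 mulrC.
by rewrite linearZ /= fu !ffdotZl u_on (negbTE ba) !mulr0.
Qed.

(** The [u a] with [mu a = x] span the eigenspace: an eigenvector [phi] satisfies
    [(mu a - x) <phi, u_a> = 0], which kills its other coefficients. *)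
Lemma dim_leigenspace x :
  \dim (passmx.leigenspace f x) = #|[pred a | mu a == x]|.
Proof.
set A := [pred a | _].
pose X := [tuple u (enum_val i) | i < #|A|].
have Xi (i : 'I_#|A|) : X`_i = u (enum_val i) by rewrite -tnth_nth tnth_mktuple.
have freeX : free X.
  apply/freeP => k k0 i; have := congr1 (fun phi => ffdot phi (u (enum_val i))) k0.
  rewrite ffdot0l ffdot_suml (bigD1 i) //= big1 ?addr0 => [|j ji].
    by rewrite Xi ffdotZl u_on eqxx mulr1.
  by rewrite Xi ffdotZl u_on (inj_eq enum_val_inj) (negbTE ji) mulr0.
suff -> : passmx.leigenspace f x = <<X>>%VS.
  by move: freeX; rewrite /free size_tuple => /eqP.
apply/vspaceP => phi; rewrite memv_ker add_lfunE opp_lfunE scale_lfunE id_lfunE subr_eq0.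
apply/eqP/idP => [fphi|].
  rewrite [phi]u_full (bigID (mem A)) /= [X in _ + X]big1 ?addr0 => [|a aA].
    apply: rpred_sum => a aA; apply: rpredZ; apply: memv_span.
    have -> : u a = X`_(enum_rank_in aA a) by rewrite Xi enum_rankK_in.
    by apply: mem_nth; rewrite size_tuple.
  have := ffdot_eigen phi a; rewrite fphi; rewrite ffdotZl => /eqP.
  rewrite -subr_eq0 -mulrBl mulf_eq0 subr_eq0 eq_sym => /orP[ax|/eqP ->].
    by rewrite inE ax in aA.
  by rewrite scale0r.
move/coord_span => ->; rewrite linear_sum scaler_sumr; apply: eq_bigr => i _.
have /eqP mx : mu (enum_val i) == x := enum_valP i.
by rewrite Xi linearZ /= fu mx scalerA mulrC -scalerA.
Qed.

Lemma positives_spectrum : positive_spectrum f (positives mu).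
Proof.
split=> [|x]; first exact: (sort_sorted le_total).
rewrite /positives (permP (permEl (perm_sort _ _))) count_map count_filter.
case: ifPn => x0; last first.
  rewrite -(count_pred0 (enum 'I_#|J|)); apply: eq_count => a /=.
  by case: eqP => // ->; rewrite (negbTE x0).
rewrite dim_leigenspace [RHS]cardE size_filter.
by rewrite enumT; apply: eq_count => a; rewrite /= !inE; case: eqP => // ->.
Qed.

End Spectrum.

(* The weights are the diagonal of the orthogonal projection
   [G^T (G G^T)^-1 G] on the row space of [G]. *)
Lemma projection_weights (R : realFieldType) n N (G : 'M[R]_(n, N)) (D : 'I_n -> R) :
    (forall i, 0 < D i) ->
    (forall c : 'rV[R]_n,
      \sum_i D i * c 0 i ^+ 2 <= ((c *m G) *m (c *m G)^T) 0 0) ->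
  exists w : 'I_N -> R,
    [/\ forall a, 0 <= w a <= 1, \sum_a w a = n%:R
      & forall a, w a <= \sum_i G i a ^+ 2 / D i].
Proof.
move=> D0 DG; pose H := G *m G^T.
have symH : H^T = H by rewrite trmx_mul trmxK.
have DH (c : 'rV[R]_n) : \sum_i D i * c 0 i ^+ 2 <= (c *m H *m c^T) 0 0.
  by have := DG c; rewrite trmx_mul !mulmxA.
(* [H] dominates a positive diagonal form, so its kernel is trivial. *)
have uH : H \in unitmx.
  rewrite -row_free_unit; apply: inj_row_free => c cH.
  have := DH c; rewrite cH mul0mx mxE.
  have D_ge0 i : true -> 0 <= D i * c 0 i ^+ 2.
    by move=> _; rewrite mulr_ge0 ?sqr_ge0 // ltW.
  move=> le0; have /psumr_eq0P h : \sum_i D i * c 0 i ^+ 2 = 0.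
    by apply/le_anti; rewrite le0 sumr_ge0.
  apply/rowP => i; rewrite mxE; apply/eqP; rewrite -sqrf_eq0.
  by have /eqP := h D_ge0 i isT; rewrite mulf_eq0 gt_eqF.
pose P := G^T *m invmx H *m G.
have symP : P^T = P by rewrite !trmx_mul trmxK trmx_inv symH mulmxA.
have PP : P *m P = P.
  by rewrite /P !mulmxA -(mulmxA _ G) -(mulmxA _ _ H) mulVmx // mulmx1.
(* [P] is a symmetric idempotent, so [P_aa] is the sum over [b] of [P_ab^2]; this places it in
   [0, 1]. *)
have Pge a : P a a ^+ 2 <= P a a.
  rewrite -{2}PP [leRHS]mxE (bigD1 a) //= expr2 lerDl; apply: sumr_ge0 => b _.
  by rewrite -{2}symP [P^T _ _]mxE -expr2 sqr_ge0.
exists (fun a => P a a); split.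
- move=> a; have h0 : 0 <= P a a := le_trans (sqr_ge0 _) (Pge a).
  rewrite h0 /=; have [->|a0] := eqVneq (P a a) 0; first exact: ler01.
  by have := Pge a; rewrite expr2 -ler_pdivlMr ?divff // lt_def a0.
- rewrite -[LHS]/(\tr P) mxtrace_mulC mulmxA mulmxV ?mxtrace1 //.
- move=> a; set v := row a G^T; pose y := v *m invmx H.
  have wE : P a a = (y *m v^T) 0 0.
    rewrite /y /v -row_mul tr_row trmxK -[P]/((G^T *m invmx H) *m G).
    by rewrite !mxE; apply: eq_bigr => i _; rewrite !mxE.
  have wE' : P a a = (y *m H *m y^T) 0 0.
    by rewrite wE /y mulmxKV // [in RHS]trmx_mul trmx_inv symH mulmxA.
  have := DH y; rewrite -wE'; set S := \sum_(i | _) _ => SP.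
  (* Completing the square replaces a comparison of inverse matrices: the expansion is [|v|^2]
     weighted by [1 / D], minus [2 P_aa], plus [S], and [S <= P_aa]. *)
  have : 0 <= \sum_i (v 0 i - D i * y 0 i) ^+ 2 / D i.
    by apply: sumr_ge0 => i _; rewrite divr_ge0 ?sqr_ge0 // ltW.
  have -> : \sum_i (v 0 i - D i * y 0 i) ^+ 2 / D i =
      \sum_i G i a ^+ 2 / D i - P a a - P a a + S.
    rewrite wE mulmx_tr_sum -!sumrB -big_split; apply: eq_bigr => i _ /=.
    rewrite !mxE; set z := \sum_(j | _) _.
    have := lt0r_neq0 (D0 i) => Di0; by field.
  by lra.
Qed.

Section TraceBound.
Variables (R : realType) (J : finType).
Notation V := {ffun J -> R^o}.

(** The coordinates [sqrt mu_a <phi, u_a>] turn the quadratic form of [f] into a plain dot product.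
    The rows of [G] are the [F i] in these coordinates, so [projection_weights] applies. *)
Lemma sum_positive_eigenvalues_le (f : 'End(V)) n (F : 'I_n -> V) (D : 'I_n -> R) :
    ffdot_selfadjoint f -> (forall phi, 0 <= ffdot (f phi) phi) ->
    (forall i, 0 < D i) ->
    (forall c : 'I_n -> R,
      \sum_i D i * c i ^+ 2 <=
        ffdot (f (\sum_i c i *: F i)) (\sum_i c i *: F i)) ->
  exists lam, [/\ positive_spectrum f lam, (n <= size lam)%N
    & \sum_(i < n) lam`_i <= \sum_i ffdot (f (F i)) (f (F i)) / D i].
Proof.
move=> symf f_ge0 D0 DF.
have [u [mu [u_on fu u_full]]] := ffun_spectral symf.
have parseval phi psi : ffdot phi psi = \sum_a ffdot phi (u a) * ffdot psi (u a).
  rewrite {1}[phi]u_full ffdot_suml; apply: eq_bigr => a _.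
  by rewrite ffdotZl [ffdot (u a) _]ffdotC.
have fE := ffdot_eigen u_on fu u_full.
have mu_ge0 a : 0 <= mu a.
  by have := f_ge0 (u a); rewrite fE u_on eqxx mulr1.
pose G := \matrix_(i < n, a < #|J|) (Num.sqrt (mu a) * ffdot (F i) (u a)).
have [c|w [w01 wn wG]] := projection_weights (G := G) D0.
  have := DF (fun i => c 0 i); congr (_ <= _).
  set phi := \sum_i _; rewrite parseval mulmx_tr_sum; apply: eq_bigr => a _.
  have -> : (c *m G) 0 a = Num.sqrt (mu a) * ffdot phi (u a).
    rewrite mxE ffdot_suml mulr_sumr; apply: eq_bigr => i _.
    by rewrite mxE ffdotZl mulrCA.
  by rewrite fE mulrACA -expr2 sqr_sqrtr // mulrA.
have G2 i a : G i a ^+ 2 = mu a * ffdot (F i) (u a) ^+ 2.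
  by rewrite mxE exprMn sqr_sqrtr.
have [|lam_size lam_sum] := sum_smallest_le mu_ge0 w01 _ wn.
  (* [G i a ^+ 2] carries the factor [mu a], so the bound on the weights makes them vanish on the
     kernel of [f]. *)
  move=> a mu0; apply/le_anti; rewrite (andP (w01 a)).1 andbT.
  by apply: (le_trans (wG a)); rewrite big1 // => i _; rewrite G2 mu0 !mul0r.
exists (positives mu); split => //; first exact: positives_spectrum u_on fu u_full.
apply: (le_trans lam_sum).
apply: (@le_trans _ _ (\sum_a mu a * \sum_i G i a ^+ 2 / D i)).
  by apply: ler_sum => a _; apply: ler_wpM2l.
under eq_bigr do rewrite mulr_sumr.
(* For fixed [i], [mu a * G i a ^+ 2] is the square of [<f F_i, u_a>], and Parseval sums these to
   [|f F_i|^2]. *)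
rewrite exchange_big; apply: ler_sum => i _; rewrite parseval mulr_suml.
by apply: ler_sum => a _; rewrite G2 fE !mulrA [in leRHS](mulrAC _ _ (mu a)).
Qed.

End TraceBound.

(** * Neighbours in the tessellation *)

Section Neighbours.
Variable n : nat.
Notation vertex := 'rV[int]_n.
Implicit Types (x y d : vertex) (k : {set 'I_n} * bool).

(** Neighbours are indexed by a direction set and a sign. The empty set gives 0 for both signs,
    hence the nonemptiness conditions below. *)
Definition sstep k : vertex := if k.2 then evec k.1 else - evec k.1.

Lemma sstepE k i : sstep k ord0 i = if i \in k.1 then (-1) ^+ ~~ k.2 else 0.
Proof.
by case: k => I [] /=; rewrite /sstep /= ?mxE evecE; case: (i \in I) => //=.
Qed.

Lemma sstep_inj k k' : k.1 != finset.set0 -> sstep k = sstep k' -> k = k'.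
Proof.
case: k k' => [I s] [I' s'] /= /finset.set0Pn[i iI] /rowP e.
have II' : I = I'.
  apply/setP => j; have := e j; rewrite !sstepE /=.
  by case: (j \in I); case: (j \in I'); case: s {e}; case: s'.
rewrite -{}II' in e *; congr (_, _).
by have := e i; rewrite !sstepE /= iI; case: s {e}; case: s'.
Qed.

Lemma adj_sstep x y :
  adj x y = [exists k, (k.1 != finset.set0) && (y == x + sstep k)].
Proof.
have evec_step (I : {set 'I_n}) : I != finset.set0 -> step (evec I).
  case/finset.set0Pn => i iI; apply/andP; split.
    by apply/eqP => /rowP/(_ i); rewrite evecE mxE iI.
  by apply/forallP => j; rewrite evecE; case: (j \in I).
have step0 d : step d -> [set i | d ord0 i == 1] != finset.set0.
  move=> sd; have [d0 _] := andP sd; apply: contraNneq d0 => e.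
  rewrite (step_evec sd) e; apply/eqP/rowP => i.
  by rewrite evecE finset.in_set0 mxE.
apply/orP/existsP => [[sd|sd]|[[I s] /andP[/= I0 /eqP ->]]].
- exists ([set i | (y - x) ord0 i == 1], true).
  by rewrite /= step0 // /sstep /= -step_evec // addrC subrK eqxx.
- exists ([set i | (x - y) ord0 i == 1], false).
  by rewrite /= step0 // /sstep /= -step_evec // opprB addrC subrK eqxx.
- rewrite opprD addrA subrr add0r (addrC x) addrK /sstep /=.
  by case: s; [left | right; rewrite opprK]; apply: evec_step.
Qed.

(** By [sstep_inj], each neighbour of [x] arises from exactly one signed direction. *)
Lemma sum_adj (T : nmodType) (S : {fset vertex}) x (F : vertex -> T) :
  \sum_(y : S | adj x (val y)) F (val y) =
  \sum_(k | (k.1 != finset.set0) && (x + sstep k \in S)) F (x + sstep k).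
Proof.
transitivity (\sum_(y : S) \sum_(k | k.1 != finset.set0)
    if val y == x + sstep k then F (val y) else 0).
  rewrite big_mkcond; apply: eq_bigr => y _; case: ifP; last first.
    move=> xy; rewrite big1 // => k k0; case: ifP => // e.
    by move: xy; rewrite adj_sstep => /existsP[]; exists k; rewrite k0.
  rewrite adj_sstep => /existsP[k /andP[k0 /eqP e]].
  rewrite (bigD1 k) //= e eqxx big1 ?addr0 // => k' /andP[_ k'k].
  by case: eqP => // /addrI /(sstep_inj k0) kk'; rewrite kk' eqxx in k'k.
rewrite exchange_big [RHS]big_mkcondr; apply: eq_bigr => k _.
case: ifPn => [kS|kS]; last first.
  by rewrite big1 // => y _; case: eqP => // e; rewrite -e (valP y) in kS.
rewrite (bigD1 [` kS]) //= eqxx big1 ?addr0 // => y yk.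
by case: eqP => // e; case/eqP: yk; apply/val_inj.
Qed.

End Neighbours.

(** * The Dirichlet-to-Neumann map *)

Section Energy.
Variables (R : realType) (n : nat) (Om : {fset 'rV[int]_n}).
Hypothesis n_gt0 : (0 < n)%N.
Notation vertex := 'rV[int]_n.
Implicit Types (phi psi : {ffun bdry Om -> R^o}) (om : {ffun clos Om -> R^o}).

Lemma tilde_adjC (x y : vertex) : tilde_adj Om x y = tilde_adj Om y x.
Proof.
by rewrite /tilde_adj adjC orbC; case: (adj y x) => //=; rewrite andbCA.
Qed.

(** The Dirichlet pairing; the factor 1/2 compensates for visiting each edge as two ordered
    pairs. *)
Definition energy om om' : R :=
  2^-1 * \sum_(x : clos Om) \sum_(y : clos Om | tilde_adj Om (val x) (val y))
           (om x - om y) * (om' x - om' y).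

Lemma energyC om om' : energy om om' = energy om' om.
Proof.
rewrite /energy; congr (_ * _); apply: eq_bigr => x _; apply: eq_bigr => y _.
exact: mulrC.
Qed.

Lemma energy_ge0 om : 0 <= energy om om.
Proof.
rewrite mulr_ge0 ?invr_ge0 //; apply: sumr_ge0 => x _.
by apply: sumr_ge0 => y _; rewrite -expr2 sqr_ge0.
Qed.

Lemma bdry_clos (v : bdry Om) : val v \in clos Om.
Proof. by rewrite inE (valP v) orbT. Qed.

(** Summation by parts: swapping [x] and [y] in half of the expanded pairing leaves the sum of
    [(om x - om y) * om' x]. Vertices of [Om] contribute 0 by harmonicity, and boundary vertices
    give the values of [DtN]. *)
Lemma green phi psi om om' :
    dirichlet_solution phi om -> dirichlet_solution psi om' ->
  ffdot (DtN R Om phi) psi = energy om om'.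
Proof.
move=> sol [_ bd'].
have [harm bd] := sol.
pose F (x y : clos Om) : R :=
  if tilde_adj Om (val x) (val y) then (om x - om y) * om' x else 0.
have -> : energy om om' = \sum_x \sum_y F x y.
  rewrite /energy; apply: (canLR (mulKf _)); first by rewrite pnatr_eq0.
  rewrite mulr2n mulrDl mul1r {2}exchange_big -big_split /=.
  apply: eq_bigr => x _; rewrite -big_split big_mkcond; apply: eq_bigr => y _ /=.
  rewrite /F tilde_adjC; case: ifP => _; last by rewrite addr0.
  by ring.
rewrite (bigID (fun x : clos Om => val x \in Om)) /= big1 ?add0r => [|x xO].
  rewrite (reindex_omap (fun v : bdry Om => [` bdry_clos v])
    (fun x => insub (val x)))/=; last first.
    move=> x xO; have xB : val x \in bdry Om.
      by have := valP x; rewrite inE (negbTE xO).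
    by rewrite insubT /=; congr Some; apply: val_inj.
  rewrite [RHS](eq_bigl predT) => [|v]; last first.
    have := valP v; rewrite in_bdry => /andP[-> _] /=.
    by rewrite valK eqxx.
  apply: eq_bigr => v _; rewrite (DtNE n_gt0 _ sol) mulr_suml.
  have vO : val v \in Om = false.
    by have := valP v; rewrite in_bdry => /andP[/negbTE ->].
  rewrite big_mkcond; apply: eq_bigr => u _.
  rewrite /F /= /tilde_adj bdry_clos (valP u) vO /= adjC andbC.
  by rewrite (bd v [` bdry_clos v] erefl) (bd' v [` bdry_clos v] erefl).
by rewrite /F -big_mkcond -mulr_suml harm ?mul0r.
Qed.

Lemma DtN_selfadjoint : ffdot_selfadjoint (DtN R Om).
Proof.
move=> phi psi.
have [om sol] := dirichlet_solution_exists n_gt0 phi.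
have [om' sol'] := dirichlet_solution_exists n_gt0 psi.
by rewrite (green sol sol') [RHS]ffdotC (green sol' sol) energyC.
Qed.

Lemma DtN_ge0 phi : 0 <= ffdot (DtN R Om phi) phi.
Proof.
have [om sol] := dirichlet_solution_exists n_gt0 phi.
by rewrite (green sol sol) energy_ge0.
Qed.

Definition coordinate (A : {fset vertex}) (i : 'I_n) : {ffun A -> R^o} :=
  [ffun x : A => ((val x : vertex) ord0 i)%:~R].

(** Defined on the whole lattice, so that additivity can be used at sums of vertices and steps. *)
Definition lincomb (c : 'I_n -> R) (x : vertex) : R :=
  \sum_i c i * (x ord0 i)%:~R.

Lemma lincombD c (x y : vertex) : lincomb c (x + y) = lincomb c x + lincomb c y.
Proof.
by rewrite -big_split; apply: eq_bigr => i _; rewrite mxE intrD mulrDr.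
Qed.

Lemma lincombN c (x : vertex) : lincomb c (- x) = - lincomb c x.
Proof.
by rewrite -sumrN; apply: eq_bigr => i _; rewrite mxE intrN mulrN.
Qed.

Lemma sum_coord (A : {fset vertex}) c (x : A) :
  (\sum_i c i *: coordinate A i) x = lincomb c (val x).
Proof. by rewrite sum_ffunE; apply: eq_bigr => i _; rewrite !ffunE. Qed.

Lemma coord_harmonic (c : 'I_n -> R) :
  dirichlet_solution (\sum_i c i *: coordinate (bdry Om) i)
    (\sum_i c i *: coordinate (clos Om) i).
Proof.
split=> [x xO|v w e]; last by rewrite !sum_coord e.
transitivity (\sum_(y : clos Om | adj (val x) (val y))
    (lincomb c (val x) - lincomb c (val y))).
  by apply: eq_big => [y|y _]; rewrite ?tilde_adjE // !sum_coord.
rewrite (sum_adj _ _ (fun y => lincomb c (val x) - lincomb c y)).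
(* All neighbours of a vertex of [Om] lie in the closure, so none is missing and the two signs of
   each direction cancel. *)
rewrite (eq_bigl (fun k : {set 'I_n} * bool => (k.1 != finset.set0) && true)).
  rewrite -(pair_big (fun I => I != finset.set0) xpredT
    (fun I s => lincomb c (val x) - lincomb c (val x + sstep (I, s)))) /=.
  rewrite big1 // => I _; rewrite big_bool /= !lincombD /sstep /= lincombN.
  by ring.
move=> k; case: (boolP (k.1 != finset.set0)) => // k0; apply: (adj_clos xO).
by rewrite adj_sstep; apply/existsP; exists k; rewrite k0 /=.
Qed.

End Energy.

(** * Counting edges *)

Lemma fset2_eq (K : choiceType) (x y x' y' : K) :
  [fset x; y] = [fset x'; y'] -> x = x' /\ y = y' \/ x = y' /\ y = x'.
Proof.
move=> /fsetP e; move: (e x) (e y) (e x') (e y'); rewrite !inE !eqxx !orbT /=.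
move=> /esym/orP[]/eqP -> /esym/orP[]/eqP ->; rewrite ?eqxx ?orbb.
- by move=> _ /eqP ->; left.
- by left.
- by right.
- by move=> /eqP ->; left.
Qed.

Section Edges.
Variables (R : realType) (n : nat) (Om : {fset 'rV[int]_n}).
Notation vertex := 'rV[int]_n.
Implicit Types (x y : vertex) (I : {set 'I_n}).

(** A step is plus or minus a nonzero 0-1 vector; as a multiple of [evec I] it must have support
    [I]. *)
Lemma parallel_sstep x y I : adj x y -> parallel R [fset x; y] (evec I) ->
  exists s, y = x + sstep (I, s).
Proof.
rewrite adj_sstep => /existsP[k /andP[/finset.set0Pn[i ik] /eqP ->]].
move=> [x' [y' [/fset2_eq e [c cP]]]].
(* The pair witnessing [parallel] may list the ends in the other order, which only changes the sign
   of the scalar. *)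
have {cP} [c' /rowP kI] : exists c' : R,
    map_mx intr (sstep k) = c' *: map_mx intr (evec I).
  case: e cP => -[<- <-]; first by rewrite addrAC subrr add0r; exists c.
  rewrite opprD addrA subrr add0r raddfN /= => /(congr1 -%R); rewrite opprK => ->.
  by exists (- c); rewrite scaleNr.
have c0 : c' != 0.
  apply/eqP => c0; have := kI i; rewrite !mxE sstepE ik c0 mul0r => /eqP.
  by rewrite intr_eq0 signr_eq0.
suff <- : k.1 = I by exists k.2; case: (k).
apply/setP => j; have := kI j; rewrite !mxE sstepE evecE.
case: (j \in k.1); case: (j \in I) => //=.
  by move/eqP; rewrite mulr0 intr_eq0 signr_eq0.
by move/esym/eqP; rewrite mulr1 (negbTE c0).
Qed.

Lemma parallel_uniq x y I J : adj x y ->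
  parallel R [fset x; y] (evec I) -> parallel R [fset x; y] (evec J) -> I = J.
Proof.
move=> xy /(parallel_sstep xy)[s yI] /(parallel_sstep xy)[t yJ].
move: xy; rewrite adj_sstep => /existsP[k /andP[k0 /eqP yk]].
have /(sstep_inj k0) kI : sstep k = sstep (I, s) by apply: (@addrI _ x); rewrite -yk.
have /(sstep_inj k0) kJ : sstep k = sstep (J, t) by apply: (@addrI _ x); rewrite -yk.
by rewrite kI in kJ; case: kJ.
Qed.

Lemma sstep_parallel x I s : parallel R [fset x + sstep (I, s); x] (evec I).
Proof.
exists (x + sstep (I, s)), x; split=> //.
rewrite opprD addrA subrr add0r /sstep /=; case: s.
  by exists (-1); rewrite raddfN scaleN1r.
by exists 1; rewrite opprK scale1r.
Qed.

(** Edges parallel to [evec I], each with its orientation along [+ evec I]. *)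
Definition up_pairs I : pred (clos Om * clos Om) :=
  [pred p | tilde_adj Om (val p.1) (val p.2) & val p.2 == val p.1 + evec I].

Lemma card_edges_le I :
  (#|` edges_parallel R (tilde_edges Om) (evec I) | <= #|up_pairs I|)%N.
Proof.
pose edge (p : clos Om * clos Om) := [fset val p.1; val p.2].
rewrite cardE -(size_map edge); apply: uniq_leq_size; first exact: fset_uniq.
move=> e; rewrite !inE /= => /andP[/imfset2P[x /= xO [y]]].
rewrite inE /= => /andP[yC xy] -> /asboolP/(parallel_sstep xy)[s ys].
have xC : x \in clos Om by rewrite inE xO.
have t_xy : tilde_adj Om x y by rewrite tilde_adjE.
apply/mapP; case: s ys => ys.
  exists ([` xC], [` yC]) => //; rewrite mem_enum inE /= t_xy.
  by apply/eqP; rewrite /= ys.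
exists ([` yC], [` xC]); last by rewrite /edge /= fsetUC.
rewrite mem_enum inE /= tilde_adjC t_xy.
by rewrite ys /sstep /= subrK.
Qed.

(** The edge from [v] to [v + sstep (I, s)] determines the pair: [v] is its end outside [Om], and
    [sstep_inj] then recovers the sign. *)
Lemma card_boundary_ge I : I != finset.set0 ->
  (#|[pred q : bdry Om * bool | (val q.1 + sstep (I, q.2))%R \in Om]|
    <= #|` edges_parallel R (bdry_edges Om) (evec I) |)%N.
Proof.
move=> I0; pose edge (q : bdry Om * bool) := [fset val q.1 + sstep (I, q.2); val q.1].
have bO (v : bdry Om) : val v \notin Om by have := valP v; rewrite in_bdry => /andP[].
rewrite cardE -(size_map edge); apply: uniq_leq_size.
  rewrite map_inj_in_uniq ?enum_uniq // => -[v s] [v' s'].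
  rewrite !mem_enum !inE /= => vO vO' /fset2_eq [] [e1 e2]; last first.
    by case/negP: (bO v); rewrite e2.
  move: e1; rewrite e2 => /addrI/(@sstep_inj _ (I, s) _ I0) [->].
  by congr (_, _); apply: val_inj.
move=> e /mapP[[v s]]; rewrite mem_enum inE /= => vO ->.
rewrite !inE /=; apply/andP; split; last by apply/asboolP; apply: sstep_parallel.
apply/imfset2P; exists (val v + sstep (I, s)) => //; exists (val v) => //.
rewrite inE (valP v) /= adjC adj_sstep; apply/existsP; exists (I, s).
by rewrite I0 /=.
Qed.

End Edges.
Arguments up_pairs {n} Om I.

(** Cauchy-Schwarz against the constant 1, read off from the nonnegative sum of the
    [(N x_i - S)^2]. *)
Lemma sqr_sum_le (R : realFieldType) (I : finType) (A : pred I) (x : I -> R) :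
  (\sum_(i in A) x i) ^+ 2 <= #|A|%:R * \sum_(i in A) x i ^+ 2.
Proof.
set S := \sum_(i in A) x i; set Q := \sum_(i in A) _; set N := #|A|%:R : R.
have [A0|A0] := posnP #|A|.
  rewrite /N A0 mul0r /S big1 ?expr0n // => i iA.
  by move/card0_eq/(_ i): A0; rewrite iA.
have N0 : 0 < N by rewrite ltr0n.
have : 0 <= \sum_(i in A) (N * x i - S) ^+ 2.
  by apply: sumr_ge0 => i _; apply: sqr_ge0.
have -> : \sum_(i in A) (N * x i - S) ^+ 2 = N * (N * Q - S ^+ 2).
  transitivity (\sum_(i in A) (N ^+ 2 * x i ^+ 2 - (2 * N * S) * x i + S ^+ 2)).
    by apply: eq_bigr => i _; ring.
  rewrite big_split sumrB -!mulr_sumr sumr_const -/S -/Q /= -mulr_natr -/N.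
  by ring.
by rewrite pmulr_rge0 // subr_ge0.
Qed.

(** Complementation exchanges the sets with and without [i], so each kind is half of all [2 ^ n]. *)
Lemma card_sets_containing n (i : 'I_n) :
  #|[pred I : {set 'I_n} | i \in I]| = (2 ^ n.-1)%N.
Proof.
case: n i => [[] //|n] i; apply/eqP; rewrite -(eqn_pmul2l (isT : 0 < 2)%N) -expnS.
have := cardC [pred I : {set 'I_n.+1} | i \in I].
have -> : #|[predC [pred I : {set 'I_n.+1} | i \in I]]| =
    #|[pred I : {set 'I_n.+1} | i \in I]|.
  rewrite -!sum1_card (reindex_inj (@finset.setC_inj _)) /=.
  by apply: eq_bigl => I; rewrite -[LHS]/(i \notin (~: I)%SET) finset.in_setC negbK.
by rewrite addnn -mul2n => ->; rewrite -cardsT -powersetT card_powerset cardsT card_ord.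
Qed.

(** * Estimates for the coordinate functions *)

Section Bounds.
Variables (R : realType) (n : nat) (Om : {fset 'rV[int]_n}).
Hypothesis n_gt0 : (0 < n)%N.
Notation vertex := 'rV[int]_n.

Lemma edges_gt0 (i : 'I_n) : Om != fset0 ->
  (0 < #|` edges_parallel R (tilde_edges Om) (evec [set i])|)%N.
Proof.
case/fset0Pn => x xO; rewrite cardfs_gt0; apply/fset0Pn.
pose y := x + sstep ([set i], true).
have xy : adj x y.
  rewrite adj_sstep; apply/existsP; exists ([set i], true).
  by rewrite /= eqxx andbT; apply/finset.set0Pn; exists i; rewrite finset.inE.
exists [fset y; x]; rewrite !inE /=; apply/andP; split.
  apply/imfset2P; exists x => //; exists y; last by rewrite fsetUC.
  by rewrite inE /= xy (adj_clos xO xy).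
by apply/asboolP; apply: sstep_parallel.
Qed.

Lemma sum_up_pairs I :
  \sum_(x : clos Om) \sum_(y : clos Om | tilde_adj Om (val x) (val y))
    (val y == val x + evec I)%:R = #|up_pairs Om I|%:R :> R.
Proof.
rewrite pair_big_dep /= -sum1_card natr_sum [LHS]big_mkcond [RHS]big_mkcond /=.
apply: eq_bigr => p _; rewrite inE /=.
by case: (tilde_adj _ _ _); case: (_ == _).
Qed.

(** An edge in direction [J] contributes the square of the sum of the [c_j] over [J]: this is
    [c_i^2] if [J] is [{i}], and the other edges are dropped as nonnegative. *)
Lemma energy_coord_ge (c : 'I_n -> R) :
  \sum_i #|` edges_parallel R (tilde_edges Om) (evec [set i])|%:R * c i ^+ 2 <=
    ffdot (DtN R Om (\sum_i c i *: coordinate R (bdry Om) i))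
      (\sum_i c i *: coordinate R (bdry Om) i).
Proof.
rewrite (green n_gt0 (coord_harmonic Om c) (coord_harmonic Om c)) /energy.
rewrite ler_pdivlMl ?ltr0n //.
(* The factor 2 comes from the 1/2 in [energy]; it is matched by the two orientations of each
   edge. *)
apply: (@le_trans _ _ (\sum_i #|up_pairs Om [set i]|%:R * c i ^+ 2 * 2)).
  rewrite mulr_sumr; apply: ler_sum => i _; rewrite mulrC ler_wpM2r //.
  by rewrite ler_wpM2r ?sqr_ge0 // ler_nat card_edges_le.
have -> : \sum_i #|up_pairs Om [set i]|%:R * c i ^+ 2 * 2 =
    \sum_(x : clos Om) \sum_(y : clos Om | tilde_adj Om (val x) (val y))
      \sum_i c i ^+ 2 * \sum_s (val y == val x + sstep ([set i], s))%:R :> R.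
  under [RHS]eq_bigr do rewrite exchange_big /=.
  rewrite exchange_big /=; apply: eq_bigr => i _.
  under [RHS]eq_bigr do rewrite -mulr_sumr.
  rewrite -mulr_sumr mulrAC mulrC; congr (_ * _).
  under [RHS]eq_bigr do under eq_bigr do rewrite big_bool /=.
  under [RHS]eq_bigr do rewrite big_split /=.
  rewrite big_split /= sum_up_pairs mulr_natr mulr2n; congr (_ + _).
  (* Pairs with [y = x - e_i] are the up pairs with [x] and [y] exchanged. *)
  rewrite -sum_up_pairs (exchange_big_dep predT) //=.
  apply: eq_bigr => x _; apply: eq_big => [y|y _]; first exact: tilde_adjC.
  by rewrite /sstep /= eq_sym -subr_eq opprK.
apply: ler_sum => x _; apply: ler_sum => y /andP[].
rewrite adj_sstep => /existsP[k /andP[k0 /eqP yk]] _.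
rewrite !sum_coord -expr2 yk lincombD opprD addrA subrr add0r sqrrN.
have eqk i s : (val x + sstep k == val x + sstep ([set i], s)) = (k == ([set i], s)).
  by apply/eqP/eqP => [/addrI/(sstep_inj k0)//|->].
under eq_bigr do under eq_bigr do rewrite eqk.
case: k k0 {yk eqk} => J t /= J0.
have [[i Ji]|Ji] := pselect (exists i, J = [set i]).
  rewrite {}Ji (bigD1 i) //= [X in _ + X]big1 ?addr0 => [|j ji]; last first.
    rewrite big1 ?mulr0 // => s _; case: eqP => // -[/finset.set1_inj ij].
    by rewrite ij eqxx in ji.
  rewrite (bigD1 t) //= eqxx big1 => [|s st]; last first.
    by case: eqP => // -[ts]; rewrite ts eqxx in st.
  rewrite addr0 mulr1 /lincomb (bigD1 i) //= big1 => [|j ji].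
    by rewrite sstepE finset.inE eqxx addr0 /= intr_sign exprMn sqrr_sign mulr1.
  by rewrite sstepE finset.inE (negbTE ji) mulr0.
rewrite big1 ?sqr_ge0 // => i _; rewrite big1 ?mulr0 // => s _.
by case: eqP => // -[e _]; case: Ji; exists i.
Qed.

(** Only directions containing [i] change the [i]-th coordinate. The sign is that of [v_i - u_i],
    hence -1 when [s] is [true], that is [u = v + evec I]. *)
Lemma DtN_coord (i : 'I_n) (v : bdry Om) :
  DtN R Om (coordinate R (bdry Om) i) v =
  \sum_(I : {set 'I_n} | i \in I) \sum_(s : bool)
    (-1) ^+ s * (val v + sstep (I, s) \in Om)%:R.
Proof.
have h : coordinate R (bdry Om) i = \sum_j (j == i)%:R *: coordinate R (bdry Om) j.
  rewrite (bigD1 i) //= eqxx scale1r big1 ?addr0 // => j /negbTE ->.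
  by rewrite scale0r.
have sol : dirichlet_solution (coordinate R (bdry Om) i) (coordinate R (clos Om) i).
  rewrite h; have := @coord_harmonic R n Om (fun j => (j == i)%:R).
  congr dirichlet_solution.
  rewrite (bigD1 i) //= eqxx scale1r big1 ?addr0 // => j /negbTE ->.
  by rewrite scale0r.
rewrite (DtNE n_gt0 v sol).
pose g (x : vertex) : R :=
  if x \in Om then ((val v : vertex) ord0 i)%:~R - (x ord0 i)%:~R else 0.
transitivity (\sum_(u : clos Om | adj (val v) (val u)) g (val u)).
  rewrite [LHS]big_mkcond [RHS]big_mkcond /=; apply: eq_bigr => u _.
  rewrite adjC /g; case: (_ \in Om); case: (adj _ _) => //=.
  by rewrite !ffunE.
rewrite sum_adj [RHS]pair_big_dep /= big_mkcond [RHS]big_mkcond /=.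
apply: eq_bigr => k _; rewrite /g.
have Om_clos x : x \in Om -> x \in clos Om by move=> xO; rewrite inE xO.
rewrite -[(k.1, k.2)]surjective_pairing mxE sstepE.
case: (boolP (i \in k.1)) => ik; last first.
  by rewrite addr0 subrr; case: ifP => // _; case: ifP.
have -> : k.1 != finset.set0 by apply/finset.set0Pn; exists i.
case: (boolP (_ \in Om)) => [vO|]; last by rewrite mulr0; case: ifP.
rewrite Om_clos // mulr1 intrD opprD addrA subrr add0r intr_sign.
by case: k.2; rewrite ?opprK.
Qed.

Lemma norm_DtN_coord_le (i : 'I_n) :
  ffdot (DtN R Om (coordinate R (bdry Om) i)) (DtN R Om (coordinate R (bdry Om) i)) <=
  2 ^+ n.-1 * \sum_(I : {set 'I_n} | i \in I)
    #|` edges_parallel R (bdry_edges Om) (evec I) |%:R.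
Proof.
apply: (@le_trans _ _ (\sum_(v : bdry Om) 2 ^+ n.-1 *
    \sum_(I : {set 'I_n} | i \in I) \sum_(s : bool)
       (val v + sstep (I, s) \in Om)%:R)).
  apply: ler_sum => v _; rewrite DtN_coord -expr2.
  apply: le_trans (sqr_sum_le _ _) _.
  rewrite card_sets_containing natrX ler_wpM2l ?exprn_ge0 //.
  apply: ler_sum => I _; rewrite !big_bool /= expr1 expr0 mul1r.
  (* With both indicators in {0, 1}, the squared difference is at most their sum. *)
  by case: (_ \in Om); case: (_ \in Om) => /=; lra.
rewrite -mulr_sumr ler_wpM2l ?exprn_ge0 // exchange_big /=.
apply: ler_sum => I iI; have I0 : I != finset.set0 by apply/finset.set0Pn; exists i.
apply: le_trans (_ : _ <= #|[pred q : bdry Om * bool |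
  (val q.1 + sstep (I, q.2))%R \in Om]|%:R) _; last first.
  by rewrite ler_nat card_boundary_ge.
rewrite pair_big /= -sum1_card natr_sum [leRHS]big_mkcond /=.
by apply: ler_sum => q _; rewrite inE; case: (_ \in Om).
Qed.

(** By [parallel_uniq] an edge is parallel to at most one [evec I], so a double count sees it at
    most once. *)
Lemma sum_parallel_le (P : pred {set 'I_n}) :
  (\sum_(I | P I) #|` edges_parallel R (bdry_edges Om) (evec I) |
    <= #|` bdry_edges Om |)%N.
Proof.
pose E := bdry_edges Om.
apply: (@leq_trans (\sum_(I | P I) \sum_(e : E | `[< parallel R (val e) (evec I) >]) 1)).
  apply: leq_sum => I _; rewrite sum1_card cardE -(size_map (val : E -> {fset vertex})).
  apply: uniq_leq_size; first exact: fset_uniq.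
  move=> e; rewrite inE /= => /andP[eE ePar]; apply/mapP; exists [` eE] => //.
  by rewrite mem_enum.
rewrite (exchange_big_dep predT) //= cardfE -sum1_card; apply: leq_sum => e _.
have [x [y [xy ->]]] : exists x y, adj x y /\ val e = [fset x; y].
  have /imfset2P[x /= _ [y]] := valP e.
  by rewrite inE => /andP[_ xy] ->; exists x, y.
rewrite sum1_card; apply/card_le1_eqP => I J.
move=> /andP[_ /asboolP IP] /andP[_ /asboolP JP].
exact: parallel_uniq xy JP IP.
Qed.

(** A set containing [i] has between 1 and [n] elements, so the range of [k] misses none. *)
Lemma sum_by_card (i : 'I_n) (F : {set 'I_n} -> R) :
  \sum_(1 <= k < n.+1) \sum_(I : {set 'I_n} | (#|I| == k) && (i \in I)) F I =
  \sum_(I : {set 'I_n} | i \in I) F I.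
Proof.
rewrite (exchange_big_dep (fun I : {set 'I_n} => i \in I)) /=; last first.
  by move=> k I _ /andP[].
apply: eq_bigr => I iI; under eq_bigl do rewrite iI andbT eq_sym.
rewrite big_nat1_eq; have -> : (0 < #|I|)%N by apply/card_gt0P; exists i.
by rewrite ltnS -[X in (_ <= X)%N]card_ord max_card.
Qed.

End Bounds.

(** * The two bounds on the sum of the first [n] positive eigenvalues *)

Theorem theorem5p1 (R : realType) (n : nat) (hn : (0 < n)%N)
    (Om : {fset 'rV[int]_n}) (hOm : Om != fset0) :
  exists lam : seq R,
    [/\ positive_spectrum (DtN R Om) lam,
        (n <= size lam)%N,
        \sum_(i < n) lam`_i <=
          2 ^+ n.-1 *
          \sum_(i < n)
            1 / #|` edges_parallel R (tilde_edges Om) (evec [set i]) |%:R *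
            \sum_(1 <= k < n.+1)
              \sum_(I : {set 'I_n} | (#|I| == k) && (i \in I))
                #|` edges_parallel R (bdry_edges Om) (evec I) |%:R
      & \sum_(i < n) lam`_i <=
          n%:R * 2 ^+ n.-1 * #|` bdry_edges Om |%:R /
          (* the default value of the minimum is irrelevant, as n is positive
             and the E_i are subsets of all the edges *)
          (\big[minn/#|` tilde_edges Om |]_(i < n)
             #|` edges_parallel R (tilde_edges Om) (evec [set i]) |)%:R].
Proof.
pose D (i : 'I_n) : R := #|` edges_parallel R (tilde_edges Om) (evec [set i])|%:R.
have D_gt0 i : 0 < D i by rewrite ltr0n edges_gt0.
have [lam [lamP lam_size lam_sum]] := sum_positive_eigenvalues_le
  (DtN_selfadjoint hn) (DtN_ge0 hn) D_gt0 (energy_coord_ge Om hn).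
(* The first bound before grouping by cardinality; both conclusions follow from it. *)
have bound : \sum_(i < n) lam`_i <= 2 ^+ n.-1 * \sum_(i < n) 1 / D i *
    \sum_(I : {set 'I_n} | i \in I) #|` edges_parallel R (bdry_edges Om) (evec I) |%:R.
  apply: le_trans lam_sum _; rewrite mulr_sumr; apply: ler_sum => i _.
  rewrite div1r [leRHS]mulrCA [leRHS]mulrC ler_wpM2r ?invr_ge0 ?(ltW (D_gt0 i)) //.
  exact: norm_DtN_coord_le.
exists lam; split=> //.
  by under [in leRHS]eq_bigr do rewrite sum_by_card.
apply: le_trans bound _; set m := \big[_/_]_(i < n) _.
have m_le i : m%:R <= D i.
  by rewrite ler_nat /m -minEnat -leEnat bigmin_le.
have m_gt0 : 0 < m%:R :> R.
  rewrite ltr0n; apply: (big_ind (fun k => 0 < k)%N).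
  (* The default value of the minimum is positive too, since all edges include the nonempty class of
     one direction. *)
  - apply: leq_trans (edges_gt0 R (Ordinal hn) hOm) (fsubset_leq_card _).
    exact: fset_sub.
  - by move=> a b a0 b0; rewrite leq_min a0.
  - by move=> i _; apply: edges_gt0.
(* Each [1 / D i] is at most [1 / m] and each inner sum at most the number of boundary edges; the
   [n] equal terms give the factor [n]. *)
apply: (@le_trans _ _ (2 ^+ n.-1 * \sum_(i < n) (m%:R^-1 * #|` bdry_edges Om |%:R))).
  rewrite ler_wpM2l ?exprn_ge0 //; apply: ler_sum => i _.
  rewrite div1r ler_pM ?invr_ge0 ?(ltW (D_gt0 i)) //; first exact: sumr_ge0.
    by rewrite lef_pV2 // posrE.
  by rewrite -natr_sum ler_nat sum_parallel_le.
rewrite sumr_const card_ord -mulr_natr le_eqVlt; apply/orP; left; apply/eqP.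
by ring.
Qed.
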